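(* Let $X$ and $Y$ be Hilbert spaces, let $f:X\to(-\infty,+\infty]$ be proper, lsc and $\rho$-weakly convex, let $g:Y\to(-\infty,+\infty]$ be proper, lsc and convex, and let $L:X\to Y$ be a bounded linear operator. Let $(x_n)_{n\in\mathbb N},(y_n)_{n\in\mathbb N}$ be the sequences generated by the primal-first primal-dual algorithm (described in the context). Assume that $\sigma\rho+\sqrt{\sigma\tau}\,\Vert L\Vert<1$ and that the primal objective $f+g\circ L$ is sharp with constant $\mu>0$ with respect to $S_P=\operatorname{argmin}(f+g\circ L)\ne\emptyset$. Put $\varepsilon_n=\operatorname{dist}(y_n,\partial g(Lx_{n+1}))$ and assume that $$(\forall n\in\mathbb N)\quad \mu^2\sigma\tau>(\sigma\rho+\sqrt{\sigma\tau}\Vert L\Vert)\,\varepsilon_n^2 .$$ Let $$E_n^{\pm}=\frac{\sigma\mu\pm\sigma\sqrt{\mu^2-\frac{\varepsilon_n^2(\sigma\rho+\sqrt{\sigma\tau}\Vert L\Vert)}{\sigma\tau}}}{\sigma\rho+\sqrt{\sigma\tau}\Vert L\Vert}.$$ (i) If at iteration $n\in\mathbb N$ one has $\operatorname{dist}(x_n,S_P)\le E_n^+$, then there exists $\xi_{n+1}\ge1$ such that $$\xi_{n+1}\left[\operatorname{dist}^2(x_{n+1},S_P)-(E_n^-)^2\right]\le\operatorname{dist}^2(x_n,S_P)-(E_n^-)^2 .$$ (ii) If $E_0^-\le\operatorname{dist}(x_0,S_P)\le E_0^+$, $\varepsilon_0>0$ and $\sum_n\varepsilon_n^2<+\infty$,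 then $\operatorname{dist}(x_n,S_P)\to0$ as $n\to\infty$.
   Context: Hilbert spaces are real. A function $f:X\to(-\infty,+\infty]$ is $\rho$-weakly convex ($\rho\ge 0$) if $f(\lambda x+(1-\lambda)y)\le\lambda f(x)+(1-\lambda)f(y)+\lambda(1-\lambda)\frac{\rho}{2}\Vert x-y\Vert^2$ for all $x,y\in X$, $\lambda\in[0,1]$ (equivalently, $f+\frac{\rho}{2}\Vert\cdot\Vert^2$ is convex). The conjugate is $g^*(y)=\sup_{w\in Y}\{\langle y,w\rangle-g(w)\}$; $\partial g$ is the convex subdifferential; $L^*$ is the adjoint of $L$; $\operatorname{dom}(g\circ L)=\{x\in X: g(Lx)<+\infty\}$; $\operatorname{dist}(z,C)=\inf_{c\in C}\Vert z-c\Vert$ (with $\inf\emptyset=+\infty$). The primal objective $f+g\circ L$ is sharp with constant $\mu>0$ with respect to its set of minimizers $S_P\neq\emptyset$ if $(f+g\circ L)(x)-\inf_{z\in X}(f+g\circ L)(z)\ge\mu\operatorname{dist}(x,S_P)$ for all $x\in X$. Primal-first primal-dual algorithm: choose $x_0\in\operatorname{dom} f\cap\operatorname{dom}(g\circ L)$, $\bar x_0=x_0$, $y_0\in Y$, and $\tau,\sigma>0$, $\theta\in[0,1]$ with $\sigma\rho<1$ and $\sqrt{\sigma\tau}\Vert L\Vert<1$. For $n\ge0$: $x_{n+1}=\operatorname{argmin}_{x\in X}\ f(x)+\frac1{2\sigma}\Vert x-x_n+\sigma L^*y_n\Vert^2$; $\bar x_{n+1}=x_{n+1}+\theta(x_{n+1}-x_n)$;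 $y_{n+1}=\operatorname{argmin}_{y\in Y}\ g^*(y)+\frac1{2\tau}\Vert y-y_n-\tau L\bar x_{n+1}\Vert^2$. *)

(* Defs.v *)
From HB Require Import structures.
From mathcomp Require Import all_boot all_order all_algebra sesquilinear.
From mathcomp Require Import all_classical all_reals all_analysis.
Set Implicit Arguments.
Unset Strict Implicit.
Unset Printing Implicit Defensive.
Import Order.TTheory GRing.Theory Num.Theory.
Import numFieldNormedType.Exports.
Local Open Scope classical_set_scope.
Local Open Scope ring_scope.

(* With the trivial involution [idfun], [{dot X for idfun}] is the type of
   symmetric positive definite bilinear forms on X. *)
HB.mixin Record isHilbert (R : realType) X of CompleteNormedModule R X := {
  inner : {dot X for idfun};
  inner_norm : forall x : X, inner x x = `|x| ^+ 2
}.

#[short(type="hilbertType")]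
HB.structure Definition Hilbert (R : realType) :=
  {X of isHilbert R X & CompleteNormedModule R X}.

Notation "''[' u , v ]" := (inner u v)
  (at level 0, format "''[' u ,  v ]") : ring_scope.

Section Operators.
Variables (R : realType) (X Y : hilbertType R).

Definition opnorm (L : X -> Y) : R := sup [set `|L x| | x in [set x | `|x| <= 1]].

(* For L linear and continuous the set below is a singleton (Riesz). *)
Definition adjoint (L : X -> Y) (y : Y) : X :=
  xget 0 [set z | forall x, '[L x, y] = '[x, z]].

End Operators.

Section ExtendedFunctions.
Variables (R : realType) (X : hilbertType R).
Implicit Types (h : X -> \bar R) (C : set X).
Local Open Scope ereal_scope.

Definition edom h : set X := [set x | h x < +oo].

Definition proper_efun h := (forall x, -oo < h x) /\ edom h !=set0.

(* At l = 0 and l = 1 the convention 0 * +oo = 0 makes the inequality trivial. *)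
Definition weakly_convex (rho : R) h := forall (x y : X) (l : R),
  (0 <= l <= 1)%R ->
  h (l *: x + (1 - l) *: y)%R <=
    l%:E * h x + (1 - l)%:E * h y + (l * (1 - l) * (rho / 2) * `|x - y| ^+ 2)%:E.

Definition convex_efun h := forall (x y : X) (l : R),
  (0 <= l <= 1)%R ->
  h (l *: x + (1 - l) *: y)%R <= l%:E * h x + (1 - l)%:E * h y.

Definition fenchel_conjugate h (y : X) : \bar R := ereal_sup [set '[y, w]%:E - h w | w in setT].

Definition subdiff h (z : X) : set X :=
  [set v | forall w, h z + '[v, (w - z)%R]%:E <= h w].

Definition argmin h : set X := [set x | forall z, h x <= h z].

(* Equal to +oo when C is empty. *)
Definition dist (z : X) C : \bar R := ereal_inf [set `|z - c|%:E | c in C].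

Definition sharp h (mu : R) C :=
  forall x, mu%:E * dist x C <= h x - ereal_inf (range h).

End ExtendedFunctions.

Section Algorithm.
Variables (R : realType) (X Y : hilbertType R).
Variables (f : X -> \bar R) (g : Y -> \bar R) (L : X -> Y).

Definition primal_objective (x : X) : \bar R := (f x + g (L x))%E.

Record primal_first_pd (rho sigma tau theta : R)
    (x xbar : nat -> X) (y : nat -> Y) : Prop := PrimalFirstPD {
  pd_sigma_gt0 : 0 < sigma;
  pd_tau_gt0 : 0 < tau;
  pd_theta : 0 <= theta <= 1;
  pd_sigma_rho : sigma * rho < 1;
  pd_step : Num.sqrt (sigma * tau) * opnorm L < 1;
  pd_init : (edom f `&` edom (g \o L)) (x 0%N);
  pd_init_bar : xbar 0%N = x 0%N;
  pd_primal : forall n, argmin (fun u =>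
      f u + (1 / (2 * sigma) * `|u - x n + sigma *: adjoint L (y n)| ^+ 2)%:E)%E
    (x n.+1);
  pd_extrapolation : forall n,
    xbar n.+1 = x n.+1 + theta *: (x n.+1 - x n);
  pd_dual : forall n, argmin (fun v =>
      fenchel_conjugate g v + (1 / (2 * tau) * `|v - y n - tau *: L (xbar n.+1)| ^+ 2)%:E)%E
    (y n.+1)
}.

Definition subgrad_gap (x : nat -> X) (y : nat -> Y) (n : nat) : \bar R :=
  dist (y n) (subdiff g (L (x n.+1))).

End Algorithm.

(* Main.v *)
Require Import Defs.
From HB Require Import structures.
From mathcomp Require Import all_boot all_order all_algebra sesquilinear.
From mathcomp Require Import all_classical all_reals all_analysis.
From mathcomp Require Import ring lra.
Set Implicit Arguments.
Unset Strict Implicit.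
Unset Printing Implicit Defensive.
Import Order.TTheory GRing.Theory Num.Theory.
Import numFieldNormedType.Exports.
Local Open Scope classical_set_scope.
Local Open Scope ring_scope.

(** Write [d_n] for the distance from [x_n] to the set [SP] of minimizers,
    [k = sigma * rho], [s = sqrt (sigma * tau) * |L|], [kappa = k + s],
    [m = sigma * mu] and [w_n = eps_n * sqrt (sigma / tau)].

    The primal step minimizes a [1/sigma - rho] strongly convex function, so its
    objective grows quadratically around [x_(n+1)] ([prox_growth]).  Evaluated at
    a minimizer [u] and combined with sharpness at [x_(n+1)] and with the
    subgradient inequality for [g], which [y_n] satisfies up to [eps_n]
    ([subdiff_dist_le]), this growth gives, with [r = |x_(n+1) - u|],
      [2 m d_(n+1) + (1 - k) r^2 - 2 s w_n r <= |x_n - u|^2]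
    ([pd_iterate_estimate]).  If [kappa = 0], then [L = 0] and [rho = 0], and
    [d_(n+1) <= d_n] follows at once; below, [kappa > 0].

    For (i), Young's inequality [2 w_n r <= r^2 + w_n^2] and the infimum over [u]
    give
      [2 m d_(n+1) + (1 - kappa) d_(n+1)^2 <= d_n^2 + s w_n^2],
    and the numbers [E_n^+] and [E_n^-] are the roots of
    [kappa t^2 - 2 m t + w_n^2], which tells when this recursion decreases [d_n]
    ([contraction_factor]).

    For (ii), iterating (i) is not enough: [eps_n] need not be monotone, and
    [d_n <= E_n^+] does not yield [d_(n+1) <= E_(n+1)^+].  Instead put
    [a = m / kappa], so that [E_n^+ <= 2 a] for every [n].  The estimate before
    Young's inequality shows that [d_n <= M] implies [d_(n+1) <= M] for every [M]
    between [a] and [2 a] ([barrier_lt]).  Since [eps_0 > 0], [d_0 <= E_0^+ < 2 a],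
    hence all [d_n] are at most some [M < 2 a].  The recursion then reads
      [kappa (2 a - M) d_(n+1) <= d_n^2 - d_(n+1)^2 + s w_n^2],
    whose right-hand side has bounded partial sums, so [d_n] is summable
    ([cvg0_of_telescoping]).

    Moving [L] across the inner product requires the adjoint to exist, which is
    the Riesz representation theorem ([riesz_representation]). *)

(** * Inner products and the Riesz representation *)

Lemma innerDl (R : realType) (X : hilbertType R) (u v w : X) :
  '[u + v, w] = '[u, w] + '[v, w].
Proof. by rewrite linearDl. Qed.

Lemma innerZl (R : realType) (X : hilbertType R) (a : R) (v w : X) :
  '[a *: v, w] = a * '[v, w].
Proof. by rewrite linearZl. Qed.

Lemma innerC (R : realType) (X : hilbertType R) (v w : X) : '[v, w] = '[w, v].
Proof. by rewrite hermC /= expr0 mul1r. Qed.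

Lemma innerDr (R : realType) (X : hilbertType R) (u v w : X) :
  '[u, v + w] = '[u, v] + '[u, w].
Proof. by rewrite linearDr. Qed.

Lemma innerZr (R : realType) (X : hilbertType R) (a : R) (v w : X) :
  '[v, a *: w] = a * '[v, w].
Proof. by rewrite linearZr. Qed.

Lemma innerBl (R : realType) (X : hilbertType R) (u v w : X) :
  '[u - v, w] = '[u, w] - '[v, w].
Proof. by rewrite linearBl. Qed.

Lemma sqr_normD (R : realType) (X : hilbertType R) (u v : X) :
  `|u + v| ^+ 2 = `|u| ^+ 2 + 2 * '[u, v] + `|v| ^+ 2.
Proof.
by rewrite -!inner_norm innerDl !innerDr (innerC v u); ring.
Qed.

Lemma sqr_normZ (R : realType) (X : hilbertType R) (a : R) (v : X) :
  `|a *: v| ^+ 2 = a ^+ 2 * `|v| ^+ 2.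
Proof. by rewrite normrZ exprMn real_normK ?num_real. Qed.

(** Cauchy-Schwarz is the triangle inequality squared. *)
Lemma inner_le_norm (R : realType) (X : hilbertType R) (u v : X) :
  '[u, v] <= `|u| * `|v|.
Proof.
have : `|u + v| ^+ 2 <= (`|u| + `|v|) ^+ 2.
  by rewrite ler_sqr ?nnegrE ?addr_ge0 ?ler_normD.
rewrite sqr_normD sqrrD mulr_natl => h.
have {}h : '[u, v] *+ 2 <= `|u| * `|v| *+ 2 by lra.
by rewrite -(ler_pMn2r (n := 2)).
Qed.

(** The Riesz representer of [phi] is the minimizer of [|v|^2 - 2 phi v]:
    the parallelogram identity makes every minimizing sequence Cauchy, and
    an almost minimizer [u] satisfies [<u, v> = phi v] up to a small error. *)
Lemma riesz_representation (R : realType) (X : hilbertType R)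
    (phi : X -> R) (C : R) :
  {morph phi : u v / u + v} -> (forall a, {morph phi : u / a *: u >-> a * u}) ->
  (forall v, phi v <= C * `|v|) ->
  exists z, forall v, phi v = '[v, z].
Proof.
move=> phiD phiZ phiC.
pose J v := `|v| ^+ 2 - 2 * phi v.
have J_lb v : - C ^+ 2 <= J v.
  have := sqr_ge0 (`|v| - C); have := phiC v; rewrite /J; nra.
pose m := inf (range J).
have hasJ : has_inf (range J).
  split; first by exists (J 0), 0.
  by exists (- C ^+ 2) => _ [v _ <-].
have mJ v : m <= J v by apply: ge_inf; [case: hasJ|exists v].
have /choice[u uP] : forall n : nat, exists v, J v < m + n.+1%:R^-1.
  move=> n; have n0 : (0 : R) < n.+1%:R^-1 by rewrite invr_gt0.
  by have [_ [v _ <-] ?] := inf_adherent n0 hasJ; exists v.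
have uu i j : `|u i - u j| ^+ 2 <= 2 * i.+1%:R^-1 + 2 * j.+1%:R^-1.
  have Ni := uP i; have Nj := uP j; have Nij := mJ (2^-1 *: (u i + u j)).
  suff : J (u i) + J (u j)
      = 2 * J (2^-1 *: (u i + u j)) + 2^-1 * `|u i - u j| ^+ 2.
    move: (J (u i)) (J (u j)) (J _) Ni Nj Nij => Ji Jj Jij.
    by move: (i.+1%:R^-1) (j.+1%:R^-1) => a b; lra.
  rewrite /J sqr_normZ phiZ phiD -[- u j]scaleN1r !sqr_normD innerZr sqr_normZ.
  by field.
have cu : cvg (u @ \oo).
  apply/cauchy_cvgP/cauchy_exP => e e0.
  have e2 : 0 < e ^+ 2 / 4 by rewrite divr_gt0// exprn_gt0.
  have [N _ HN] := near_infty_natSinv_lt (PosNum e2).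
  exists (u N); exists N => // n /= Nn.
  rewrite -ball_normE /ball_ /=.
  rewrite -(ltr_pXn2r (_ : 0 < 2)%N) ?nnegrE ?(ltW e0)//.
  apply: le_lt_trans (uu N n) _.
  have hN : N.+1%:R^-1 < e ^+ 2 / 4 := HN N (leqnn N).
  have hn : n.+1%:R^-1 < e ^+ 2 / 4 := HN n Nn.
  by move: (n.+1%:R^-1) (N.+1%:R^-1) hn hN => a b; lra.
pose z := lim (u @ \oo).
exists z => v; apply/eqP; rewrite -subr_eq0 -normr_le0.
(* Along a line through the almost minimizer [u n], [J] stays above
   [J (u n) - 1 / (n + 1)]; the discriminant of this quadratic inequality
   bounds the slope at [u n]. *)
have grad n : (phi v - '[v, u n]) ^+ 2 <= `|v| ^+ 2 * n.+1%:R^-1.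
  set b := phi v - _; set a := `|v| ^+ 2.
  have quad t : 2 * t * b <= t ^+ 2 * a + n.+1%:R^-1.
    have := mJ (u n + t *: v); have := uP n.
    rewrite /J sqr_normD innerZr sqr_normZ phiD phiZ (innerC (u n)).
    by rewrite /b /a; move: (n.+1%:R^-1) => d; lra.
  have a0 : 0 <= a by rewrite sqr_ge0.
  have [a_eq0|a_neq0] := eqVneq a 0.
    have n0 : (0 : R) < n.+1%:R^-1 by rewrite invr_gt0.
    suff -> : b = 0 by rewrite a_eq0 expr0n mul0r.
    apply: contrapT => /eqP b0.
    have := quad (n.+1%:R^-1 / b); rewrite a_eq0 mulr0 add0r.
    by rewrite -mulrA divfK //; move: (n.+1%:R^-1) n0 => d; lra.
  have := quad (b / a); rewrite expr_div_n [a ^+ 2]expr2.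
  have agt0 : 0 < a by rewrite lt_neqAle eq_sym a_neq0.
  have -> : 2 * (b / a) * b = 2 * (b ^+ 2 / a) by field.
  have -> : b ^+ 2 / (a * a) * a = b ^+ 2 / a by field.
  move=> h; have : b ^+ 2 / a <= n.+1%:R^-1.
    by move: (_ / a) (n.+1%:R^-1) h => c d; lra.
  by rewrite ler_pdivrMr// mulrC.
apply/ler_addgt0Pr => e e0; rewrite add0r.
(* Half of [e] for the slope at [u n], half for replacing [u n] by [z]. *)
pose e' := e / (2 * (1 + `|v|)).
have v1 : 0 < 1 + `|v| by rewrite ltr_pwDl.
have e'0 : 0 < e' by rewrite divr_gt0 ?mulr_gt0.
have e'2 : 0 < e' ^+ 2 by rewrite exprn_gt0.
have ev : 2 * (e' * `|v|) <= e.
  have -> : e = 2 * (e' * (1 + `|v|)) by rewrite /e'; field; lra.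
  by rewrite ler_pM2l// ler_pM2l//; lra.
near \oo => n.
have -> : phi v - '[v, z] = (phi v - '[v, u n]) + '[u n - z, v].
  by rewrite innerBl (innerC (u n)) (innerC z); ring.
apply: (le_trans (ler_normD _ _)); apply: le_trans ev.
rewrite mulr_natl mulr2n; apply: lerD.
  have e'v : 0 <= e' * `|v| by rewrite mulr_ge0 ?(ltW e'0).
  rewrite -[leRHS]ger0_norm// -ler_sqr ?nnegrE// !real_normK ?num_real//.
  apply: (le_trans (grad n)); rewrite exprMn mulrC ler_wpM2r ?sqr_ge0//.
  by apply: ltW; near: n; exact: (near_infty_natSinv_lt (PosNum e'2)).
have uz : `|u n - z| <= e'.
  rewrite distrC; apply: ltW; near: n.
  by move/cvgrPdist_lt : cu; exact.
have h1 := inner_le_norm (u n - z) v.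
have h2 := inner_le_norm (-1 *: (u n - z)) v.
rewrite innerZl scaleN1r normrN in h2.
have h3 : `|u n - z| * `|v| <= e' * `|v| by rewrite ler_wpM2r.
by rewrite ler_norml; apply/andP; split; lra.
Unshelve. all: by end_near. Qed.

(** * Operator norm and adjoint *)

Lemma le_opnorm (R : realType) (X Y : hilbertType R) (L : {linear X -> Y})
    (v : X) :
  continuous L -> `|L v| <= opnorm L * `|v|.
Proof.
move=> cL.
have /linear_boundedP bL : bounded_near L (nbhs (0 : X)).
  by apply/linear_bounded_continuous.
near (@pinfty_nbhs R) => C.
have CL w : `|L w| <= C * `|w|.
  by move: w; near: C; exact: bL.
have C0 : 0 <= C by near: C; exact: nbhs_pinfty_ge.
have [->|v0] := eqVneq v 0; first by rewrite linear0 !normr0 mulr0.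
have nv : 0 < `|v| by rewrite normr_gt0.
have -> : `|L v| = `|L (`|v|^-1 *: v)| * `|v|.
  by rewrite linearZ normrZ normfV normr_id mulrC mulrA divff ?mul1r ?gt_eqF.
rewrite ler_wpM2r//; apply: ub_le_sup; last first.
  by exists (`|v|^-1 *: v) => //=; rewrite normrZ normfV normr_id mulVf ?gt_eqF.
exists C => _ [w /= w1 <-]; apply: (le_trans (CL w)).
by rewrite -[leRHS]mulr1 ler_wpM2l.
Unshelve. all: by end_near. Qed.

Lemma opnorm_ge0 (R : realType) (X Y : hilbertType R) (L : {linear X -> Y}) :
  0 <= opnorm L.
Proof.
rewrite /opnorm; set A := image _ _.
have A0 : A 0 by exists 0; rewrite /= ?linear0 ?normr0.
have [ubA|nubA] := pselect (has_ubound A); first exact: ub_le_sup.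
by rewrite sup_out// => -[].
Qed.

Lemma inner_adjoint (R : realType) (X Y : hilbertType R) (L : {linear X -> Y})
    (y : Y) (v : X) :
  continuous L -> '[L v, y] = '[v, adjoint L y].
Proof.
move=> cL; rewrite /adjoint; case: xgetP => [z _ /= zP|noadj]; first exact: zP.
have [|||z zP] := @riesz_representation _ _ (fun v => '[L v, y]) (opnorm L * `|y|).
- by move=> u w /=; rewrite linearD innerDl.
- by move=> a u /=; rewrite linearZ innerZl.
- move=> u; apply: (le_trans (inner_le_norm _ _)).
  by rewrite mulrAC ler_wpM2r// le_opnorm.
by have := noadj z; case => /=.
Qed.

(** * Quadratic growth at a proximal point *)

Lemma sqr_norm_conv (R : realType) (X : hilbertType R) (l : R) (u v c : X) :
  `|l *: u + (1 - l) *: v - c| ^+ 2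
  = l * `|u - c| ^+ 2 + (1 - l) * `|v - c| ^+ 2 - l * (1 - l) * `|u - v| ^+ 2.
Proof.
have -> : l *: u + (1 - l) *: v - c = l *: (u - c) + (1 - l) *: (v - c).
  by rewrite !scalerBr addrACA -opprD -scalerDl subrKC scale1r.
have -> : u - v = (u - c) + (-1) *: (v - c).
  by rewrite scaleN1r opprB addrA subrK.
move: (u - c) (v - c) => a b.
by rewrite !sqr_normD !sqr_normZ !innerZr innerZl; ring.
Qed.

(** Adding [|. - c|^2 / (2 sigma)] turns the weakly convex [f] into a
    [1/sigma - rho] strongly convex function, which therefore grows
    quadratically around its minimizer [p].  The growth is read off
    from the values on the segment from [p] to [u], arbitrarily close to [p]. *)
Lemma prox_growth (R : realType) (X : hilbertType R) (f : X -> \bar R)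
    (rho sigma fu fp : R) (c p u : X) :
  0 < sigma -> weakly_convex rho f ->
  argmin (fun v => f v + (1 / (2 * sigma) * `|v - c| ^+ 2)%:E)%E p ->
  f u = fu%:E -> f p = fp%:E ->
  fp + 1 / (2 * sigma) * `|p - c| ^+ 2 + (1 / sigma - rho) / 2 * `|u - p| ^+ 2
  <= fu + 1 / (2 * sigma) * `|u - c| ^+ 2.
Proof.
move=> s0 wcf minp fuE fpE.
pose A := fu + 1 / (2 * sigma) * `|u - c| ^+ 2
  - (fp + 1 / (2 * sigma) * `|p - c| ^+ 2).
set B := (1 / sigma - rho) / 2 * `|u - p| ^+ 2.
suff : B <= A by rewrite /A; lra.
have AB l : 0 < l -> l < 1 -> (1 - l) * B <= A.
  move=> l0 l1.
  have l01 : 0 <= l <= 1 by rewrite !ltW.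
  have := le_trans (minp (l *: u + (1 - l) *: p)) (leeD2r _ (wcf u p l l01)).
  rewrite fuE fpE -!EFinM -!EFinD lee_fin sqr_norm_conv => h.
  rewrite -(ler_pM2l l0) /A /B.
  have -> : (1 / sigma - rho) / 2 = 1 / (2 * sigma) - rho / 2.
    by field; rewrite gt_eqF.
  move: h; move: (1 / (2 * sigma)) => k; lra.
apply/ler_addgt0Pr => e e0.
(* With [l = e / d], the loss [l * B] is at most [e], and [l < 1]. *)
pose d := 1 + e + `|B|.
have d0 : 0 < d by rewrite /d ltr_pwDl// addr_gt0.
have l0 : 0 < e / d by rewrite divr_gt0.
have l1 : e / d < 1 by rewrite ltr_pdivrMr// mul1r /d; have := normr_ge0 B; lra.
have := AB _ l0 l1; have : e / d * B <= e.
  rewrite mulrAC ler_pdivrMr// ler_pM2l// /d; have := ler_norm B; lra.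
lra.
Qed.

(** * Distance to a set and approximate subgradients *)

Lemma dist_fin_num (R : realType) (X : hilbertType R) (z : X) (C : set X) :
  C !=set0 -> dist z C \is a fin_num.
Proof.
move=> [c Cc]; rewrite ge0_fin_numE.
  by apply: (@le_lt_trans _ _ `|z - c|%:E); [apply: ereal_inf_lbound; exists c|exact: ltry].
by apply/ereal_infP => _ [b _ <-]; rewrite lee_fin.
Qed.

Lemma dist_ge0 (R : realType) (X : hilbertType R) (z : X) (C : set X) :
  (0 <= dist z C)%E.
Proof. by apply/ereal_infP => _ [b _ <-]; rewrite lee_fin. Qed.

Lemma fine_dist_le (R : realType) (X : hilbertType R) (z c : X) (C : set X) :
  C c -> fine (dist z C) <= `|z - c|.
Proof.
move=> Cc; rewrite -lee_fin fineK; last by apply: dist_fin_num; exists c.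
by apply: ereal_inf_lbound; exists c.
Qed.

Lemma le_fine_dist (R : realType) (X : hilbertType R) (z : X) (C : set X) (K : R) :
  C !=set0 -> (forall c, C c -> K <= `|z - c|) -> K <= fine (dist z C).
Proof.
move=> C0 KC; rewrite -lee_fin fineK; last exact: dist_fin_num.
by apply/ereal_infP => _ [c Cc <-]; rewrite lee_fin KC.
Qed.

Lemma le_sqr_fine_dist (R : realType) (X : hilbertType R) (z : X) (C : set X)
    (K : R) :
  C !=set0 -> (forall c, C c -> K <= `|z - c| ^+ 2) ->
  K <= fine (dist z C) ^+ 2.
Proof.
move=> C0 KC; have [K0|K0] := ltP K 0.
  exact: le_trans (ltW K0) (sqr_ge0 _).
rewrite -(sqr_sqrtr K0) ler_sqr ?nnegrE ?sqrtr_ge0 ?fine_ge0 ?dist_ge0//.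
apply: le_fine_dist => // c Cc.
by rewrite -[leRHS]ger0_norm// -sqrtr_sqr ler_wsqrtr// KC.
Qed.

(** The subgradient inequality survives for a vector [y] near the
    subdifferential, up to an error proportional to its distance from it. *)
Lemma subdiff_dist_le (R : realType) (Y : hilbertType R) (g : Y -> \bar R)
    (y z w : Y) :
  (forall w, -oo < g w)%E -> subdiff g z !=set0 -> edom g w ->
  (g z + ('[y, w - z] - fine (dist y (subdiff g z)) * `|w - z|)%:E <= g w)%E.
Proof.
move=> gNy sub0 gw; case: (sub0) => v0 v0P.
have /(_ w) := v0P; move: gw (gNy w) (gNy z); rewrite /edom /=.
case gwE : (g w) => [gw| |]//; case gzE : (g z) => [gz| |]// _ _ _.
rewrite -EFinD !lee_fin => h0.
suff : gz + '[y, w - z] - gw <= fine (dist y (subdiff g z)) * `|w - z| by lra.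
have hv v : subdiff g z v -> gz + '[y, w - z] - gw <= `|y - v| * `|w - z|.
  move=> /(_ w); rewrite gwE gzE -EFinD lee_fin => vw.
  have := inner_le_norm (y - v) (w - z); rewrite innerBl; lra.
have [wz0|wz0] := eqVneq `|w - z| 0.
  by have := hv _ v0P; rewrite wz0 !mulr0.
have wzgt0 : 0 < `|w - z| by rewrite lt_neqAle eq_sym wz0 normr_ge0.
rewrite -ler_pdivrMr//; apply: le_fine_dist => // v vP.
by rewrite ler_pdivrMr// hv.
Qed.

(** * One step of the algorithm *)

(** One primal step, seen from an arbitrary minimizer [u]: quadratic growth
    of the proximal objective at [xp] is combined with the approximate
    subgradient inequality for [g] (error [p]) and with sharpness at [xp].
    The two occurrences of [L^* y], in the step and in the subgradient
    inequality, cancel. *)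
Lemma primal_step_estimate (R : realType) (X Y : hilbertType R)
    (f : X -> \bar R) (g : Y -> \bar R) (L : {linear X -> Y})
    (rho sigma mu p : R) (xn xp u : X) (yn : Y) :
  let F := primal_objective f g L in
  let SP := argmin F in
  0 < sigma ->
  (forall v, -oo < f v)%E -> (forall w, -oo < g w)%E ->
  weakly_convex rho f -> continuous L -> sharp F mu SP ->
  argmin (fun v => f v +
    (1 / (2 * sigma) * `|v - xn + sigma *: adjoint L yn| ^+ 2)%:E)%E xp ->
  SP u -> (F u < +oo)%E ->
  (g (L xp) + ('[yn, L u - L xp] - p * `|u - xp|)%:E <= g (L u))%E ->
  2 * (sigma * mu) * fine (dist xp SP) + (1 - sigma * rho) * `|xp - u| ^+ 2
    - 2 * (sigma * p) * `|xp - u| <= `|xn - u| ^+ 2.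
Proof.
move=> F SP s0 fNy gNy wcf cL shF minp SPu Fu hg.
have inf_F : ereal_inf (range F) = F u.
  apply/eqP; rewrite eq_le; apply/andP; split.
    by apply: ereal_inf_lbound; exists u.
  by apply/ereal_infP => _ [v _ <-]; exact: SPu.
have SP0 : SP !=set0 by exists u.
have := shF xp; rewrite inf_F -(fineK (dist_fin_num xp SP0)).
set D := fine _.
have [fu fuE] : exists r, f u = r%:E.
  move: (fNy u) (gNy (L u)) Fu; rewrite /F /primal_objective.
  by case: (f u) => [r| |]//; [exists r|case: (g _)].
have [gu guE] : exists r, g (L u) = r%:E.
  move: (fNy u) (gNy (L u)) Fu; rewrite /F /primal_objective.
  by case: (g _) => [r| |]//; [exists r|case: (f _)].
have [gp gpE] : exists r, g (L xp) = r%:E.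
  by move: hg (gNy (L xp)); rewrite guE; case: (g _) => [r| |]//; exists r.
have [fp fpE] : exists r, f xp = r%:E.
  by move: (minp u) (fNy xp); rewrite fuE; case: (f _) => [r| |]//; exists r.
move: hg; rewrite /F /primal_objective fuE guE gpE fpE -!EFinD -EFinM !lee_fin.
move=> hg hD.
pose a := adjoint L yn.
have minp' : argmin (fun v => f v +
    (1 / (2 * sigma) * `|v - (xn - sigma *: a)| ^+ 2)%:E)%E xp.
  by move=> z; have := minp z; rewrite !opprB !addrA ![_ + sigma *: _ - xn]addrAC.
have := prox_growth s0 wcf minp' fuE fpE.
have shift v : `|v - (xn - sigma *: a)| ^+ 2
    = `|xn - v| ^+ 2 + 2 * sigma * '[v - xn, a] + sigma ^+ 2 * `|a| ^+ 2.
  have -> : v - (xn - sigma *: a) = (v - xn) + sigma *: a.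
    by rewrite opprB addrCA addrC.
  by rewrite (sqr_normD (v - xn)) innerZr sqr_normZ distrC mulrA.
rewrite !shift => hp.
have ya : '[yn, L u - L xp] = '[u - xn, a] - '[xp - xn, a].
  by rewrite -linearB innerC inner_adjoint// -innerBl opprB addrA subrK.
rewrite ya (distrC u xp) in hg; rewrite (distrC u xp) in hp.
have {}hp : 2 * sigma * fp + `|xn - xp| ^+ 2 + 2 * sigma * '[xp - xn, a]
    + (1 - sigma * rho) * `|xp - u| ^+ 2
    <= 2 * sigma * fu + `|xn - u| ^+ 2 + 2 * sigma * '[u - xn, a].
  rewrite -(lerD2r (sigma ^+ 2 * `|a| ^+ 2)).
  rewrite -(ler_pM2l (_ : 0 < 1 / (2 * sigma))); last by rewrite divr_gt0 ?mulr_gt0.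
  by apply: le_trans (le_trans _ hp) _; rewrite le_eqVlt; apply/orP; left;
    apply/eqP; field; rewrite gt_eqF.
have {}hg := ler_wpM2l (ltW s0) hg.
have {}hD := ler_wpM2l (ltW s0) hD.
rewrite [fine D%:E]/=.
have := sqr_ge0 `|xn - xp|; lra.
Qed.

(** The one-step estimate along the algorithm, with the error [eps_n] measured
    on the scale [w = eps_n * sqrt (sigma / tau)], on which the assumed bound
    on [eps_n] reads [kappa * w^2 < (sigma * mu)^2].  If [L = 0] there is no
    error at all, even where [g] has no subgradient. *)
Lemma pd_iterate_estimate (R : realType) (X Y : hilbertType R)
    (f : X -> \bar R) (g : Y -> \bar R) (L : {linear X -> Y})
    (rho sigma tau theta mu : R) (x xbar : nat -> X) (y : nat -> Y)
    (n : nat) (u : X) :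
  let F := primal_objective f g L in
  let SP := argmin F in
  let eps := subgrad_gap g L x y in
  proper_efun f -> weakly_convex rho f -> proper_efun g -> continuous L ->
  primal_first_pd f g L rho sigma tau theta x xbar y -> sharp F mu SP ->
  opnorm L = 0 \/ eps n \is a fin_num -> SP u ->
  2 * (sigma * mu) * fine (dist (x n.+1) SP)
    + (1 - sigma * rho) * `|x n.+1 - u| ^+ 2
    - 2 * (Num.sqrt (sigma * tau) * opnorm L
           * (fine (eps n) * Num.sqrt (sigma / tau))) * `|x n.+1 - u|
  <= `|x n - u| ^+ 2.
Proof.
move=> F SP eps [fNy _] wcf [gNy _] cL pd shF epsn SPu.
have s0 := pd_sigma_gt0 pd; have t0 := pd_tau_gt0 pd.
have Fu : (F u < +oo)%E.
  apply: le_lt_trans (SPu (x 0%N)) _; have [fx gx] := pd_init pd.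
  exact: lte_add_pinfty.
have gu : edom g (L u).
  move: (fNy u) Fu; rewrite /edom/= /F /primal_objective.
  by case: (f u) (g (L u)) (gNy (L u)) => [r| |] [q| |].
pose p := fine (eps n) * opnorm L.
have -> : Num.sqrt (sigma * tau) * opnorm L
    * (fine (eps n) * Num.sqrt (sigma / tau)) = sigma * p.
  have st : Num.sqrt (sigma * tau) * Num.sqrt (sigma / tau) = sigma.
    rewrite -sqrtrM ?mulr_ge0 ?ltW// -[in RHS](ger0_norm (ltW s0)) -sqrtr_sqr.
    by congr Num.sqrt; field; rewrite gt_eqF.
  by rewrite -[in RHS]st /p; ring.
apply: (primal_step_estimate s0 fNy gNy wcf cL shF (pd_primal pd n)) => //.
have Lu v : `|L v| <= opnorm L * `|v| by exact: le_opnorm.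
case: epsn => [L0|epsn].
  have L_0 v : L v = 0.
    by apply/eqP; rewrite -normr_le0 (le_trans (Lu v))// L0 mul0r.
  by rewrite /p L0 !L_0 subrr linear0r mulr0 mul0r subrr adde0.
have sub0 : subdiff g (L (x n.+1)) !=set0.
  apply: contrapT => /nonemptyPn sub0; move: epsn.
  by rewrite /eps /subgrad_gap sub0 /dist image_set0 ereal_inf0.
apply: le_trans (subdiff_dist_le (y n) gNy sub0 gu).
apply: leeD2l; rewrite lee_fin lerD2l lerN2 /p -mulrA.
by rewrite ler_wpM2l ?fine_ge0 ?dist_ge0// -linearB.
Qed.

(** * Scalar recursions *)

(** Young's inequality leaves the recursion [h D <= d^2 + w^2] for
    [h t = (1 - kappa) t^2 + 2 m t], and [(m +- rad) / kappa] are the two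
    solutions of [h t = t^2 + w^2].  As [h] is increasing, [d <= (m + rad) / kappa]
    excludes [D > (m + rad) / kappa]; between the two solutions [h] forces
    [D <= d]; below the smaller one both brackets may be negative, and the
    factor [xi] is their ratio. *)
Lemma contraction_factor (R : realType) (kappa m w rad d D : R) :
  let Em := (m - rad) / kappa in
  0 < kappa -> kappa < 1 -> 0 < m -> 0 <= rad ->
  rad ^+ 2 = m ^+ 2 - kappa * w ^+ 2 -> 0 <= d -> 0 <= D ->
  2 * m * D + (1 - kappa) * D ^+ 2 <= d ^+ 2 + w ^+ 2 ->
  d <= (m + rad) / kappa ->
  exists2 xi : R, 1 <= xi & xi * (D ^+ 2 - Em ^+ 2) <= d ^+ 2 - Em ^+ 2.
Proof.
move=> Em k0 k1 m0 rad0 radE d0 D0 hD; set Ep := _ / kappa => dEp.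
have kEm : kappa * Em = m - rad by rewrite /Em mulrC divfK ?gt_eqF.
have kEp : kappa * Ep = m + rad by rewrite /Ep mulrC divfK ?gt_eqF.
have [Dd|dD] := leP D d.
  by exists 1 => //; rewrite mul1r lerD2r ler_sqr.
have DEm : D < Em.
  rewrite ltNge; apply/negP => EmD.
  have q1 : 0 <= kappa * D - (m - rad) by rewrite -kEm -mulrBr mulr_ge0 ?subr_ge0// ltW.
  have dD2 : d ^+ 2 < D ^+ 2 by rewrite ltr_sqr.
  have q12 : 0 < (kappa * D - (m - rad)) * (kappa * D - (m + rad)).
    have -> : (kappa * D - (m - rad)) * (kappa * D - (m + rad))
      = kappa * (kappa * D ^+ 2 - 2 * m * D + w ^+ 2).
      have -> : (kappa * D - (m - rad)) * (kappa * D - (m + rad))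
        = (kappa * D - m) ^+ 2 - rad ^+ 2 by ring.
      by rewrite radE; ring.
    by rewrite mulr_gt0//; lra.
  have q2 : kappa * Ep < kappa * D.
    rewrite kEp -subr_gt0 ltNge; apply/negP => q2.
    by have := mulr_ge0_le0 q1 q2; rewrite leNgt q12.
  have {}q2 : Ep < D by rewrite -(ltr_pM2l k0).
  have Ep0 : 0 <= Ep by exact: le_trans dEp.
  have Ep2 : Ep ^+ 2 < D ^+ 2 by rewrite ltr_sqr.
  have dEp2 : d ^+ 2 <= Ep ^+ 2 by rewrite ler_sqr.
  have hEp : 2 * m * Ep + (1 - kappa) * Ep ^+ 2 = Ep ^+ 2 + w ^+ 2.
    apply: (mulfI (lt0r_neq0 k0)).
    have -> : kappa * (2 * m * Ep + (1 - kappa) * Ep ^+ 2)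
      = kappa * Ep ^+ 2 + 2 * m * (kappa * Ep) - (kappa * Ep) ^+ 2 by ring.
    rewrite kEp [RHS]mulrDr.
    have -> : kappa * w ^+ 2 = m ^+ 2 - rad ^+ 2 by rewrite radE; ring.
    by ring.
  have : m * Ep < m * D by rewrite ltr_pM2l.
  have : (1 - kappa) * Ep ^+ 2 < (1 - kappa) * D ^+ 2.
    by rewrite ltr_pM2l// subr_gt0.
  lra.
have Em0 : 0 <= Em by rewrite ltW// (le_lt_trans D0).
have neg : D ^+ 2 - Em ^+ 2 < 0 by rewrite subr_lt0 ltr_sqr.
exists ((d ^+ 2 - Em ^+ 2) / (D ^+ 2 - Em ^+ 2)); last by rewrite divfK ?lt_eqF.
by rewrite ler_ndivlMr// mul1r lerD2r ler_sqr// ltW.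
Qed.

(** Every level [M] between [a] and [2 a] is a barrier: the left-hand side
    of the one-step estimate increases in [D] and in [r >= D] beyond [M], and
    at [D = r = M] it is already at least [M^2].  The error is kept here as
    [2 s w r]; splitting it by Young's inequality would lose the barriers
    close to [2 a].  In the application [k = sigma * rho],
    [s = sqrt (sigma * tau) * |L|] and [a = sigma * mu / (k + s)]. *)
Lemma barrier_lt (R : realType) (k s a w M D r : R) :
  0 <= k -> 0 <= s -> 0 < k + s -> k + s < 1 -> 0 < a -> 0 <= w ->
  w ^+ 2 < (k + s) * a ^+ 2 -> a <= M -> M <= 2 * a -> M < D -> D <= r ->
  2 * ((k + s) * a) * D + (1 - k) * D ^+ 2 - 2 * (s * w) * D
    <= 2 * ((k + s) * a) * D + (1 - k) * r ^+ 2 - 2 * (s * w) * r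
  /\ M ^+ 2 < 2 * ((k + s) * a) * D + (1 - k) * D ^+ 2 - 2 * (s * w) * D.
Proof.
move=> k0 s0 ks0 ks1 a0 w0 wa aM M2a MD Dr.
have wlta : w < a.
  rewrite -ltr_sqr ?nnegrE// ?ltW//; apply: (lt_le_trans wa).
  by rewrite -[leRHS]mul1r ler_wpM2r ?sqr_ge0 ?ltW.
have sw_kM : s * w <= (1 - k) * M.
  apply: (@le_trans _ _ (s * M)); first by rewrite ler_wpM2l// ltW// (lt_le_trans wlta).
  by apply: ler_wpM2r; lra.
have sw_a : s * w <= (k + s) * a.
  by apply: ler_pM => //; [rewrite lerDr|exact: ltW].
have M0 : 0 < M by exact: lt_le_trans aM.
have k1 : 0 < 1 - k by lra.
have kMD : (1 - k) * M <= (1 - k) * D by rewrite ler_pM2l// ltW.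
have kMr : (1 - k) * M <= (1 - k) * r by rewrite ler_pM2l// ltW// (lt_le_trans MD).
split.
  have : 0 <= (r - D) * ((1 - k) * (r + D) - 2 * (s * w)).
    by rewrite mulr_ge0 ?subr_ge0//; lra.
  lra.
have h1 : 0 < (D - M) * (2 * ((k + s) * a - s * w) + (1 - k) * (D + M)).
  apply: mulr_gt0; first lra.
  by have := mulr_gt0 k1 M0; lra.
have h2 : 0 <= M * (2 * ((k + s) * a) - 2 * (s * w) - k * M).
  apply: mulr_ge0; first exact: ltW.
  have := ler_wpM2l k0 M2a; have := ler_wpM2l s0 (ltW wlta); lra.
lra.
Qed.

Lemma cvg0_of_telescoping (R : realType) (d b : nat -> R) (K B : R) :
  0 < K -> (forall n, 0 <= d n) ->
  (forall n, K * d n.+1 + d n.+1 ^+ 2 <= d n ^+ 2 + b n) ->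
  (forall n, \sum_(0 <= i < n) b i <= B) ->
  d n @[n --> \oo] --> 0.
Proof.
move=> K0 d0 step bB.
have tel n : K * (\sum_(0 <= i < n) d i.+1) + d n ^+ 2
    <= d 0%N ^+ 2 + \sum_(0 <= i < n) b i.
  elim: n => [|n IH]; first by rewrite !big_geq// mulr0 add0r addr0.
  by rewrite !big_nat_recr//= mulrDr; have := step n; lra.
have : cvgn (series (fun i => d i.+1)).
  apply: nondecreasing_is_cvgn.
    by apply/nondecreasing_seqP => n; rewrite /series/= big_nat_recr//= lerDl.
  exists ((d 0%N ^+ 2 + B) / K) => _ [n _ <-].
  rewrite ler_pdivlMr// mulrC /series/=.
  by have := tel n; have := bB n; have := sqr_ge0 (d n); lra.
by move/cvg_series_cvg_0; rewrite -(cvg_shiftS d).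
Qed.

(** * Convergence of the distance to the minimizers *)

Theorem theorem4 (R : realType) (X Y : hilbertType R)
    (f : X -> \bar R) (g : Y -> \bar R) (L : {linear X -> Y})
    (rho sigma tau theta mu : R)
    (x xbar : nat -> X) (y : nat -> Y) :
  0 <= rho ->
  proper_efun f -> lower_semicontinuous f -> weakly_convex rho f ->
  proper_efun g -> lower_semicontinuous g -> convex_efun g ->
  continuous L ->
  primal_first_pd f g L rho sigma tau theta x xbar y ->
  let F := primal_objective f g L in
  let SP := argmin F in
  let kappa := sigma * rho + Num.sqrt (sigma * tau) * opnorm L in
  let eps := subgrad_gap g L x y in
  let rad n := sigma * Num.sqrt
    (mu ^+ 2 - fine (eps n) ^+ 2 * kappa / (sigma * tau)) in
  let Eplus n := (sigma * mu + rad n) / kappa in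
  let Eminus n := (sigma * mu - rad n) / kappa in
  kappa < 1 ->
  0 < mu -> SP !=set0 -> sharp F mu SP ->
  (forall n, kappa%:E * eps n ^+ 2 < (mu ^+ 2 * sigma * tau)%:E)%E ->
  (forall n, (dist (x n) SP <= (Eplus n)%:E)%E ->
    exists2 xi : R, 1 <= xi &
      (xi%:E * (dist (x n.+1) SP ^+ 2 - (Eminus n ^+ 2)%:E) <=
       dist (x n) SP ^+ 2 - (Eminus n ^+ 2)%:E)%E)
  /\
  (((Eminus 0%N)%:E <= dist (x 0%N) SP <= (Eplus 0%N)%:E)%E ->
   (0 < eps 0%N)%E ->
   (\sum_(0 <= n <oo) eps n ^+ 2 < +oo)%E ->
   dist (x n) SP @[n --> \oo] --> 0%E).
Proof.
move=> rho0 pf _ wcf pg _ _ cL pd F SP kappa eps rad Eplus Eminus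
  kappa1 mu0 SP0 shF epsP.
have s0 := pd_sigma_gt0 pd; have t0 := pd_tau_gt0 pd.
pose m := sigma * mu; have m0 : 0 < m by rewrite mulr_gt0.
pose k := sigma * rho; have k0 : 0 <= k by rewrite mulr_ge0// ltW.
have st0 : 0 < Num.sqrt (sigma * tau) by rewrite sqrtr_gt0 mulr_gt0.
pose s := Num.sqrt (sigma * tau) * opnorm L.
have s_ge0 : 0 <= s by rewrite mulr_ge0 ?opnorm_ge0// ltW.
have kappaE : kappa = k + s by [].
pose d n := fine (dist (x n) SP).
have dE n : dist (x n) SP = (d n)%:E by rewrite fineK// dist_fin_num.
have d0 n : 0 <= d n by rewrite fine_ge0// dist_ge0.
have eps0 n : (0 <= eps n)%E by exact: dist_ge0.
pose w n := fine (eps n) * Num.sqrt (sigma / tau).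
have w0 n : 0 <= w n by rewrite mulr_ge0 ?sqrtr_ge0// fine_ge0.
have w2 n : w n ^+ 2 = fine (eps n) ^+ 2 * (sigma / tau).
  by rewrite exprMn sqr_sqrtr// divr_ge0// ltW.
have d_le n K : (forall u, SP u -> K <= `|x n - u| ^+ 2) -> K <= d n ^+ 2.
  exact: le_sqr_fine_dist.
have d_r n u : SP u -> d n <= `|x n - u| by exact: fine_dist_le.
have [kappa_eq0|kappa_neq0] := eqVneq kappa 0.
  (* Here [rho = 0] and [L = 0]; both [Eplus] and [Eminus] are [0], as
     division by [kappa] gives [0]. *)
  have ks0 : k = 0 /\ s = 0 by split; lra.
  have L0 : opnorm L = 0.
    by apply/eqP; move/eqP: ks0.2; rewrite mulf_eq0 gt_eqF.
  have dS n : d n.+1 <= d n.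
    rewrite -ler_sqr ?nnegrE//; apply: d_le => u SPu.
    have := pd_iterate_estimate (n := n) pf wcf pg cL pd shF (or_introl L0) SPu.
    rewrite -/F -/SP -/(d n.+1) -/m -/k -/s ks0.1 ks0.2 !mul0r mulr0 mul0r.
    have : d n.+1 ^+ 2 <= `|x n.+1 - u| ^+ 2 by rewrite ler_sqr ?nnegrE// d_r.
    have := mulr_ge0 (ltW m0) (d0 n.+1); lra.
  split=> [n _|/andP[_]].
    exists 1 => //; rewrite mul1e !dE -!EFin_expe -!EFinB lee_fin.
    by rewrite lerD2r ler_sqr ?nnegrE.
  rewrite /Eplus kappa_eq0 invr0 mulr0 dE lee_fin => d00 _ _.
  have dn0 n : d n = 0.
    apply/eqP; rewrite eq_le d0 andbT.
    by elim: n => // n IH; apply: le_trans IH.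
  by rewrite (_ : (fun n => _) = cst 0%E) ?dE; [exact: cvg_cst|
    apply/funext => n; rewrite dE dn0].
have kappa0 : 0 < kappa by rewrite lt_neqAle eq_sym kappa_neq0 kappaE addr_ge0.
have eps_fin n : eps n \is a fin_num.
  rewrite ge0_fin_numE// ltey; apply: contraTN (epsP n) => /eqP ->.
  by rewrite expe2 mulyy gt0_muley// -leNgt leey.
pose e n := fine (eps n).
have epsE n : eps n = (e n)%:E by rewrite fineK.
have step n u : SP u -> 2 * m * d n.+1 + (1 - k) * `|x n.+1 - u| ^+ 2
    - 2 * (s * w n) * `|x n.+1 - u| <= `|x n - u| ^+ 2.
  exact: (pd_iterate_estimate (n := n) pf wcf pg cL pd shF (or_intror (eps_fin n))).
(* Young's inequality, in the form [s * (r - w)^2 >= 0]. *)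
have young n : 2 * m * d n.+1 + (1 - kappa) * d n.+1 ^+ 2
    <= d n ^+ 2 + s * w n ^+ 2.
  rewrite -lerBlDr; apply: d_le => u SPu; have := step n u SPu.
  have : (1 - kappa) * d n.+1 ^+ 2 <= (1 - kappa) * `|x n.+1 - u| ^+ 2.
    apply: ler_wpM2l; first by rewrite subr_ge0 ltW.
    by rewrite ler_sqr ?nnegrE// d_r.
  have := mulr_ge0 s_ge0 (sqr_ge0 (`|x n.+1 - u| - w n)).
  rewrite kappaE; lra.
have e_lt n : kappa * e n ^+ 2 < mu ^+ 2 * sigma * tau.
  by have := epsP n; rewrite epsE -EFin_expe -EFinM lte_fin.
have w_lt n : kappa * w n ^+ 2 < m ^+ 2.
  have -> : m ^+ 2 = mu ^+ 2 * sigma * tau * (sigma / tau).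
    by rewrite /m; field; rewrite gt_eqF.
  by rewrite w2 mulrA ltr_pM2r ?divr_gt0//; exact: e_lt.
have radE n : rad n ^+ 2 = m ^+ 2 - kappa * w n ^+ 2.
  rewrite /rad exprMn sqr_sqrtr.
    by rewrite w2 /m; field; rewrite !gt_eqF.
  rewrite subr_ge0 ler_pdivrMr ?mulr_gt0//; have := e_lt n; rewrite /e; lra.
have rad0 n : 0 <= rad n by rewrite mulr_ge0 ?sqrtr_ge0// ltW.
split=> [n|/andP[_]].
  rewrite !dE lee_fin => dEp.
  have [|xi xi1 xiP] := @contraction_factor _ kappa m (w n) (rad n) (d n) (d n.+1)
    kappa0 kappa1 m0 (rad0 n) (radE n) (d0 n) (d0 n.+1) _ dEp.
    apply: le_trans (young n) _; rewrite lerD2l -[leRHS]mul1r.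
    by rewrite ler_wpM2r ?sqr_ge0//; lra.
  by exists xi => //; rewrite -!EFin_expe -!EFinB -EFinM lee_fin.
rewrite dE epsE lee_fin lte_fin => d0E e0 sumw.
pose a := m / kappa.
have a0 : 0 < a by rewrite divr_gt0.
have ka : kappa * a = m by rewrite /a mulrC divfK.
have w_lta n : w n ^+ 2 < kappa * a ^+ 2.
  have -> : kappa * a ^+ 2 = m ^+ 2 / kappa by rewrite -ka; field.
  by rewrite ltr_pdivlMr// mulrC.
have d0_lt : d 0%N < 2 * a.
  apply: le_lt_trans d0E _; rewrite /Eplus -/m ltr_pdivrMr//.
  suff : rad 0%N < m by move: ka; lra.
  rewrite -ltr_sqr ?nnegrE// ?(ltW m0)// radE ltrBlDr ltrDl mulr_gt0//.
  by rewrite exprn_gt0// mulr_gt0// sqrtr_gt0 divr_gt0.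
pose M := Num.max a (d 0%N).
have aM : a <= M by rewrite le_max lexx.
have M2a : M < 2 * a by rewrite gt_max d0_lt andbT; lra.
(* [M] lies in the range [a, 2 a] of the barriers. *)
have dM n : d n <= M.
  elim: n => [|n IH]; first by rewrite le_max lexx orbT.
  rewrite leNgt; apply/negP => MD.
  have bar r : d n.+1 <= r -> _ := barrier_lt k0 s_ge0 kappa0 kappa1 a0
    (w0 n) (w_lta n) aM (ltW M2a) MD.
  have [_] := bar _ (lexx _); rewrite -kappaE ka ltNge => /negP; apply.
  apply: (@le_trans _ _ (d n ^+ 2)); last by rewrite ler_sqr ?nnegrE// (le_trans (d0 n)).
  apply: d_le => u SPu; apply: le_trans (step n u SPu).
  by have [] := bar _ (d_r _ _ SPu); rewrite -kappaE ka.
have [B BP] : exists B, forall n, \sum_(0 <= i < n) e i ^+ 2 <= B.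
  exists (fine (\sum_(0 <= n <oo) eps n ^+ 2)%E) => n.
  rewrite -lee_fin fineK; last first.
    by rewrite ge0_fin_numE// nneseries_ge0// => i _ _; rewrite expe_ge0.
  rewrite -sumEFin (eq_bigr (fun i => (eps i ^+ 2)%E)).
    by apply: nneseries_lim_ge => i _; rewrite expe_ge0.
  by move=> i _; rewrite epsE EFin_expe.
have d_cvg : d n @[n --> \oo] --> 0.
  apply: (@cvg0_of_telescoping _ d (fun n => s * w n ^+ 2) (kappa * (2 * a - M))
    (s * (sigma / tau) * B)) => //.
  - by rewrite mulr_gt0// subr_gt0.
  - move=> n; have := young n.
    have : kappa * d n.+1 * d n.+1 <= kappa * d n.+1 * M.
      by rewrite ler_wpM2l ?mulr_ge0// ltW.
    have := congr1 ( *%R (2 * d n.+1)) ka; lra.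
  - move=> n; rewrite (eq_bigr (fun i => s * (sigma / tau) * e i ^+ 2)).
      by rewrite -mulr_sumr ler_wpM2l// mulr_ge0// divr_ge0// ltW.
    by move=> i _; rewrite w2 /e; ring.
rewrite (_ : (fun n => _) = EFin \o d); last by apply/funext.
by apply: cvg_EFin => //; exact: nearW.
Qed.
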